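(* For every instance $(G,c,V_R)$ of the Steiner Traveling Salesman Problem which has a (feasible) solution, there exists an optimal solution in which the total number of edge traversals (counting traversals in either direction, with multiplicity) does not exceed $2(|V|-1)$, where $V$ is the node set of $G$.
   Context: The Steiner Traveling Salesman Problem (STSP): an instance consists of a finite undirected graph $G=(V,E)$ (not necessarily complete), a positive integer cost $c_e$ for each edge $e\in E$, and a set $V_R\subseteq V$ of required nodes. A feasible solution is a closed walk in $G$ (possibly of length zero) that visits every node of $V_R$ at least once; nodes may be visited more than once, edges may be traversed more than once, and nodes outside $V_R$ need not be visited. The cost of a solution is $\sum_{e\in E} c_e x_e$, where $x_e\in\mathbb{Z}_{\ge 0}$ is the number of times edge $e$ is traversed (in either direction). A solution is optimal if it has minimum cost among all feasible solutions. The total number of edge traversals of a solution is $\sum_{e\in E}x_e$. *)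

(* Defs.v *)
From mathcomp Require Import all_boot.

Set Implicit Arguments.
Unset Strict Implicit.
Unset Printing Implicit Defensive.

(* The graph is simple: an edge is a set of exactly two nodes. *)
Record stsp (V : finType) := Stsp {
  edges : {set {set V}};
  cost : {set V} -> nat;
  required : {set V};
  edges_card2 : forall e, e \in edges -> #|e| = 2;
  cost_gt0 : forall e, e \in edges -> 0 < cost e
}.

(* A walk is given by its start node and the sequence of the nodes reached by
   its successive steps, so [(u, [::])] is the walk of length zero at u. *)
Definition walk (V : finType) : Type := (V * seq V)%type.

Section STSP.

Variables (V : finType) (I : stsp V).
Implicit Types (w : walk V) (e : {set V}).

Definition adj : rel V := [rel u v | [set u; v] \in edges I].

Definition walk_nodes w : seq V := w.1 :: w.2.

Definition walk_edges w : seq {set V} :=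
  pairmap (fun u v => [set u; v]) w.1 w.2.

Definition closed_walk w : bool := path adj w.1 w.2 && (last w.1 w.2 == w.1).

Definition feasible w : bool :=
  closed_walk w && [forall v in required I, v \in walk_nodes w].

Definition traversals w e : nat := count_mem e (walk_edges w).

Definition walk_cost w : nat :=
  \sum_(e in edges I) cost I e * traversals w e.

Definition total_traversals w : nat := \sum_(e in edges I) traversals w e.

Definition optimal w : Prop :=
  feasible w /\ forall w', feasible w' -> walk_cost w <= walk_cost w'.

End STSP.

(* Main.v *)
Require Import Defs.
From mathcomp Require Import all_boot.

(** Let a closed walk traverse more than 2(n - 1) edges, where n is the number
    of nodes.  The steps that discover a new node form a spanning tree T of the
    visited nodes, with at most n - 1 edges, so at least n steps remain.  Among
    n edges on n nodes, counted with multiplicity, there is a nonempty family C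
    in which every node has even degree (for instance a cycle, or two copies of
    one edge).  Deleting C keeps all degrees even, and the rest is connected
    because it still contains T; so by Euler's theorem the rest is again a
    closed walk.  It visits the same nodes, is strictly shorter, and costs no
    more, since it only uses edge copies of the original walk.

    The family C comes from counting rather than from a search for a cycle
    ([even_subfamily]): the map from subfamilies to their degree parities goes
    from a set of at least 2^n elements to one of 2^n elements, and it misses
    any parity vector with exactly one odd entry by the handshake lemma; so two
    different subfamilies have the same parities, and their symmetric
    difference is C.  Euler's theorem is [eulerian_extension], and
    [shorten_closed_walk] combines the two.

    Iterating, every feasible walk is dominated by one with at most 2(n - 1)
    steps ([feasible_short]).  There are finitely many walks that short, so a
    cheapest one among them exists, and it is optimal among all feasible
    walks. *)

(** * Closed walks and even edge families *)

Section ClosedWalks.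

Set Implicit Arguments.
Unset Strict Implicit.

Context {V : finType}.
Implicit Types (x y z v : V) (p q : seq V) (e : {set V}) (E T R C K : seq {set V}).

Definition loopless E : bool := all (fun e => #|e| == 2) E.

Definition degree E v : nat := count (fun e => v \in e) E.

Definition even_degrees E : Prop := forall v, ~~ odd (degree E v).

(** The edges of E link x to all of W.  The formulation by closed sets of nodes
    avoids paths: it is monotone in E, and applying it to the set of nodes of a
    walk tells at once whether the walk has reached everything. *)
Definition connects x E (W : seq V) : Prop :=
  forall S : {set V}, x \in S ->
    (forall e y, e \in E -> y \in e -> y \in S -> e \subset S) ->
    {subset W <= S}.

Lemma connects_sub x E1 E2 W :
  {subset E1 <= E2} -> connects x E1 W -> connects x E2 W.
Proof.
move=> sE cE1 S xS clS; apply: cE1 => // e y eE1; exact: clS (sE e eE1).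
Qed.

Lemma degree_cat E1 E2 v : degree (E1 ++ E2) v = degree E1 v + degree E2 v.
Proof. exact: count_cat. Qed.

Lemma degree_perm E1 E2 v : perm_eq E1 E2 -> degree E1 v = degree E2 v.
Proof. by rewrite /degree => /permP ->. Qed.

Lemma odd_mem_pair x y v :
  #|[set x; y]| == 2 -> (v \in [set x; y]) = (v == x) (+) (v == y).
Proof.
rewrite cards2 !inE; case: (eqVneq v x) => [->|//]; case: (x == y) => //.
Qed.

Lemma pair_endpoint e x :
  #|e| == 2 -> x \in e -> exists2 z, e = [set x; z] & z != x.
Proof.
move=> /cards2P [a [b [ab ->]]]; rewrite !inE => /orP [] /eqP ->.
  by exists b; rewrite // eq_sym.
by exists a; rewrite // setUC.
Qed.

Lemma walk_edges_cons x z p :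
  walk_edges (x, z :: p) = [set x; z] :: walk_edges (z, p).
Proof. by []. Qed.

Lemma walk_edges_cat x p q :
  walk_edges (x, p ++ q) = walk_edges (x, p) ++ walk_edges (last x p, q).
Proof. exact: pairmap_cat. Qed.

Lemma size_walk_edges x p : size (walk_edges (x, p)) = size p.
Proof. exact: size_pairmap. Qed.

Lemma walk_edge_nodes x p e y :
  e \in walk_edges (x, p) -> y \in e -> y \in x :: p.
Proof.
elim: p x => // z p IH x; rewrite walk_edges_cons inE => /orP [/eqP ->|ep ye].
  by rewrite !inE orbA => ->.
by rewrite inE (IH z) ?orbT.
Qed.

Lemma odd_degree_walk x p v :
  loopless (walk_edges (x, p)) ->
  odd (degree (walk_edges (x, p)) v) = (v == x) (+) (v == last x p).
Proof.
elim: p x => [|z p IH] x; first by rewrite /degree /= addbb.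
rewrite walk_edges_cons /= => /andP [cxz cp].
rewrite /degree /= oddD oddb odd_mem_pair // [odd _](IH z cp).
by rewrite addbA -(addbA (v == x)) addbb addbF.
Qed.

(** Leave x along any edge, which exists because the degree of x is odd; deleting
    that edge moves the odd node x to the other endpoint, so the walk can go on
    until it is at y. *)
Lemma trail_of_odd_degrees E x y :
  loopless E -> (forall v, odd (degree E v) = (v == x) (+) (v == y)) ->
  exists p E', last x p = y /\ perm_eq E (walk_edges (x, p) ++ E').
Proof.
have [n] := ubnP (size E); elim: n => // n IH in E x *.
rewrite ltnS => sE cE dE; have [<-|xy] := eqVneq x y.
  by exists [::], E; split.
have: has (fun e => x \in e) E.
  by rewrite has_count -/(degree E x) odd_gt0 // dE eqxx (negPf xy).
case/hasP=> e eE xe.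
have [z def_e zx] := pair_endpoint (allP cE e eE) xe.
have pE := perm_to_rem eE.
have cE1 : loopless (e :: rem e E) by rewrite /loopless -(perm_all _ pE).
case/andP: cE1 => ce cE1.
have [|v|p [E' [lp pE']]] := IH (rem e E) z _ cE1.
- by apply: leq_trans sE; rewrite (perm_size pE).
- have := dE v; rewrite (degree_perm _ pE) /degree /= oddD oddb.
  rewrite def_e odd_mem_pair -?def_e //.
  by case: (v == x); case: (v == z); case: (v == y); case: (odd _).
exists (z :: p), E'; split=> //.
by rewrite walk_edges_cons -def_e (permPl pE) /= perm_cons.
Qed.

(** Euler's theorem, as a closed walk p that absorbs the unused edges E.  While
    an unused edge has an endpoint z on p, a trail among the unused edges leads
    back to z and is spliced into p there; what is left over is even again.
    Once no unused edge touches p, the nodes of p form a closed set, so they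
    exhaust W and no edge is left. *)
Lemma eulerian_extension x p E W :
  last x p = x -> loopless E -> even_degrees E ->
  (forall e y, e \in E -> y \in e -> y \in W) ->
  connects x (walk_edges (x, p) ++ E) W ->
  exists q, last x q = x /\ perm_eq (walk_edges (x, q)) (walk_edges (x, p) ++ E).
Proof.
have [n] := ubnP (size E); elim: n => // n IH in E p *.
rewrite ltnS => sE lp cE dE EW conn.
have [/hasP [e eE /existsP [z /andP [ze zp]]]|noE] :=
  boolP (has (fun e => [exists z, (z \in e) && (z \in x :: p)]) E).
  have [t def_e _] := pair_endpoint (allP cE e eE) ze.
  have pE := perm_to_rem eE.
  have : loopless (e :: rem e E) by rewrite /loopless -(perm_all _ pE).
  case/andP=> ce cE1.
  have [v|q [E' [lq pE']]] := @trail_of_odd_degrees _ t z cE1.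
    have := dE v; rewrite (degree_perm _ pE) /degree /= oddD oddb.
    rewrite def_e odd_mem_pair -?def_e //.
    by case: (v == z); case: (v == t); case: (odd _).
  have pEc : perm_eq E (walk_edges (z, t :: q) ++ E').
    by rewrite walk_edges_cons -def_e (permPl pE) /= perm_cons.
  case: (splitPl zp) lp conn => p1 p2 lp1 lp conn {p zp}.
  have pew : perm_eq (walk_edges (x, p1 ++ (t :: q) ++ p2) ++ E')
                     (walk_edges (x, p1 ++ p2) ++ E).
    rewrite !walk_edges_cat lp1 [last z _]lq -!catA perm_cat2l.
    by rewrite perm_catCA perm_cat2l perm_sym.
  have sub : {subset E' <= E}.
    by move=> f fE'; rewrite (perm_mem pEc) mem_cat fE' orbT.
  have [||||||r [lr pr]] := IH E' (p1 ++ (t :: q) ++ p2).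
  - apply: leq_trans sE; rewrite (perm_size pEc) size_cat size_walk_edges /=.
    by rewrite addSn ltnS leq_addl.
  - by rewrite !last_cat lp1 /= lq -lp1 -last_cat.
  - by apply/allP => f /sub; apply: (allP cE).
  - move=> v; have := dE v; rewrite (degree_perm _ pEc) degree_cat oddD.
    rewrite odd_degree_walk /= ?lq ?addbb //.
    have : loopless (walk_edges (z, t :: q) ++ E').
      by rewrite /loopless -(perm_all _ pEc).
    by rewrite /loopless all_cat => /andP [].
  - by move=> f y /sub; apply: EW.
  - by apply: connects_sub conn => f; rewrite (perm_mem pew).
  by exists r; split; rewrite // (permPl pr).
have Wp : {subset W <= [set y in x :: p]}.
  apply: conn => [|e y]; first by rewrite !inE eqxx.
  rewrite mem_cat => /orP [ep _ _|eE ye]; last first.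
    rewrite inE => yp; case/hasP: noE; exists e => //.
    by apply/existsP; exists y; rewrite ye.
  by apply/subsetP => z ze; rewrite inE (walk_edge_nodes ep).
have E0 : E = [::].
  apply/eqP; rewrite -size_eq0 -leqn0 leqNgt -has_predT; apply/hasP => -[e eE _].
  have /set0Pn [y ye] : e != set0 by rewrite -card_gt0 (eqP (allP cE e eE)).
  case/hasP: noE; exists e => //; apply/existsP; exists y.
  by rewrite ye -[_ \in _]/(y \in x :: p); have := Wp y (EW e y eE ye); rewrite inE.
by exists p; rewrite E0 cats0.
Qed.

(** T consists of the steps at which the walk reaches a node for the first
    time. *)
Lemma spanning_tree_of_walk x p :
  exists T R, [/\ perm_eq (walk_edges (x, p)) (T ++ R),
                  size T < #|[set y in x :: p]| & connects x T (x :: p)].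
Proof.
elim/last_ind: p => [|p z [T [R [pTR sT cT]]]].
  exists [::], [::]; split=> // [|S xS _ y].
    by apply/card_gt0P; exists x; rewrite !inE eqxx.
  by rewrite inE => /eqP ->.
have wE : walk_edges (x, rcons p z) = rcons (walk_edges (x, p)) [set last x p; z].
  by rewrite -cats1 walk_edges_cat cats1.
have nE : [set y in x :: rcons p z] = z |: [set y in x :: p].
  by apply/setP => y; rewrite inE -rcons_cons mem_rcons !inE.
have pe : perm_eq (walk_edges (x, rcons p z)) ([set last x p; z] :: T ++ R).
  by rewrite wE perm_rcons perm_cons.
have [zp|zp] := boolP (z \in x :: p).
  exists T, ([set last x p; z] :: R); split.
  - by rewrite (permPl pe) perm_sym (perm_catCA T [:: _]).
  - apply: leq_trans sT _; rewrite nE; exact: subset_leq_card (subsetUr _ _).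
  move=> S xS clS y; rewrite -rcons_cons mem_rcons inE => /orP [/eqP ->|yp];
    exact: cT.
exists ([set last x p; z] :: T), R; split=> //.
  by rewrite nE cardsU1 inE zp.
move=> S xS clS.
have sub : {subset x :: p <= S}.
  by apply: cT => // e y eT; apply: clS; rewrite inE eT orbT.
move=> y; rewrite -rcons_cons mem_rcons inE => /orP [/eqP ->|]; last exact: sub.
have /subsetP : [set last x p; z] \subset S.
  by apply: (clS _ (last x p)); rewrite ?sub ?mem_last // !inE eqxx.
by apply; rewrite !inE eqxx orbT.
Qed.

Lemma sum_degree E : loopless E -> \sum_v degree E v = (size E).*2.
Proof.
elim: E => [|e E IH]; first by rewrite big1.
move=> /andP [/eqP ce cE].
rewrite (eq_bigr (fun v => (v \in e) + degree E v)) // big_split /= IH //.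
by rewrite -big_mkcond sum1_card ce.
Qed.

(** Pigeonhole over the two-element field: if the degree parities determined the
    subfamily, then, there being at least as many subfamilies as parity
    vectors, every parity vector would occur, even one with a single odd entry,
    whose degree sum would be odd.
    Hence two subfamilies agree in parity, and C is their symmetric
    difference. *)
Lemma even_subfamily R :
  0 < #|V| -> loopless R -> #|V| <= size R ->
  exists C K, [/\ perm_eq R (C ++ K), C != [::] & even_degrees C].
Proof.
move=> /card_gt0P [x0 _] cR sR.
(* Subfamilies are selected by position, since edges may be repeated in R. *)
pose sel (m : {ffun 'I_(size R) -> bool}) :=
  [seq tnth (in_tuple R) i | i <- enum 'I_(size R) & m i].
pose par m : {ffun V -> bool} := [ffun v => odd (degree (sel m) v)].
have parE m v : par m v =
    \big[addb/false]_(i < size R) (m i && (v \in tnth (in_tuple R) i)).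
  rewrite ffunE /degree /sel count_map count_filter -sum1_count.
  rewrite (big_morph odd oddD (erefl : odd 0 = false)) big_mkcond big_enum /=.
  by apply: eq_bigr => i _; rewrite andbC; case: (m i && _).
have sel_perm m : perm_eq R (sel m ++ sel [ffun i => ~~ m i]).
  rewrite -{1}[R](map_tnth_enum (in_tuple R)) perm_sym.
  rewrite /sel -map_cat perm_map //.
  rewrite (eq_filter (a1 := [ffun i => ~~ m i]) (a2 := predC m)) ?perm_filterC //.
  by move=> i; rewrite ffunE.
have csel m : loopless (sel m).
  by have := cR; rewrite /loopless (perm_all _ (sel_perm m)) all_cat => /andP [].
have : ~~ injectiveb par.
  apply/negP => /injectiveP /inj_card_bij.
  rewrite !card_ffun card_bool card_ord leq_exp2l // => /(_ sR) [g _ gK].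
  have := congr1 odd (sum_degree (csel (g [ffun v => v == x0]))).
  rewrite odd_double (big_morph odd oddD (erefl : odd 0 = false)).
  rewrite (eq_bigr (fun v => v == x0)); last first.
    by move=> v _; have /ffunP/(_ v) := gK [ffun v => v == x0]; rewrite !ffunE.
  rewrite (bigD1 x0) //= eqxx big1 //.
  by move=> v /negPf.
case/injectivePn=> m1 [m2 m12 par12].
pose m : {ffun 'I_(size R) -> bool} := [ffun i => m1 i (+) m2 i].
exists (sel m), (sel [ffun i => ~~ m i]); split=> //.
  apply: contra m12 => /eqP m0; apply/eqP/ffunP => i; apply/eqP.
  have : i \notin [seq i <- enum 'I_(size R) | m i].
    by apply/negP => im; have := map_f (tnth (in_tuple R)) im; rewrite -/(sel m) m0.
  by rewrite mem_filter mem_enum andbT ffunE; case: (m1 i); case: (m2 i).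
move=> v; have <- : par m v = odd (degree (sel m) v) by rewrite ffunE.
rewrite parE; under eq_bigr do rewrite ffunE andb_addl.
by rewrite big_split /= -!parE par12 addbb.
Qed.

(** At least #|V| steps lie outside the spanning tree T of discovering steps, so
    an even family C can be removed from them; T keeps the rest connected. *)
Lemma shorten_closed_walk x p :
  last x p = x -> loopless (walk_edges (x, p)) -> 2 * (#|V| - 1) < size p ->
  exists q C, [/\ last x q = x, C != [::],
    perm_eq (walk_edges (x, p)) (C ++ walk_edges (x, q)) &
    {subset x :: p <= x :: q}].
Proof.
move=> lp cp sp.
have V0 : 0 < #|V| by apply/card_gt0P; exists x.
have [T [R [pTR sT cT]]] := spanning_tree_of_walk x p.
have : loopless (T ++ R) by rewrite /loopless -(perm_all _ pTR).
rewrite /loopless all_cat => /andP [cardT cardR].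
have sR : #|V| <= size R.
  have := perm_size pTR; rewrite size_walk_edges size_cat => spE.
  rewrite leqNgt; apply: contraL sp => ltR; rewrite -leqNgt spE subn1 mul2n -addnn.
  by rewrite leq_add // -ltnS prednK // (leq_trans sT) ?max_card.
have [C [K [pR C0 dC]]] := even_subfamily V0 cardR sR.
have pCTK : perm_eq (walk_edges (x, p)) (C ++ (T ++ K)).
  by rewrite (permPl pTR) perm_sym perm_catCA perm_cat2l perm_sym.
have memTK : {subset T ++ K <= walk_edges (x, p)}.
  by move=> e eTK; rewrite (perm_mem pCTK) mem_cat eTK orbT.
have [||v|e y /memTK||q [lq pq]] := @eulerian_extension x [::] (T ++ K) (x :: p).
- by [].
- by apply/allP => e /memTK; apply: (allP cp).
- have := odd_degree_walk v cp; rewrite lp addbb.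
  by rewrite (degree_perm _ pCTK) degree_cat oddD (negPf (dC v)) addFb => ->.
- exact: walk_edge_nodes.
- by apply: connects_sub cT => e eT; rewrite /= mem_cat eT.
exists q, C; split=> //; first by rewrite (permPl pCTK) perm_cat2l perm_sym.
have sub : {subset x :: p <= [set y in x :: q]}.
  apply: cT => [|e y eT _ _]; first by rewrite !inE eqxx.
  apply/subsetP => z ze; rewrite inE; apply: walk_edge_nodes ze.
  by rewrite (perm_mem pq) /= mem_cat eT.
by move=> y /sub; rewrite inE.
Qed.

End ClosedWalks.

(** * Feasible solutions of an instance *)

Section Instance.

Set Implicit Arguments.
Unset Strict Implicit.

Context {V : finType} (I : stsp V).
Implicit Types (x : V) (p : seq V) (w : walk V).

Lemma path_adjE x p :
  path (adj I) x p = all (fun e => e \in edges I) (walk_edges (x, p)).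
Proof. by elim: p x => //= z p IH x; rewrite IH. Qed.

Lemma loopless_path x p : path (adj I) x p -> loopless (walk_edges (x, p)).
Proof.
by rewrite path_adjE; apply: sub_all => e /(edges_card2 (s := I)) ->.
Qed.

Lemma sum_traversals w (F : {set V} -> nat) :
  closed_walk I w ->
  \sum_(e in edges I) F e * traversals w e = \sum_(e <- walk_edges w) F e.
Proof.
case: w => x p /andP [/= + _]; rewrite path_adjE /traversals.
elim: (walk_edges _) => [|a E IH] /=.
  by rewrite big_nil big1 // => e _; rewrite muln0.
case/andP=> aI /IH; rewrite big_cons => <-.
under eq_bigr do rewrite mulnDr; rewrite big_split /=; congr (_ + _).
rewrite (bigD1 a) //= eqxx muln1 big1 ?addn0 // => e /andP [_ ea].
by rewrite eq_sym (negPf ea) muln0.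
Qed.

Lemma total_traversalsE w : closed_walk I w -> total_traversals I w = size w.2.
Proof.
move=> cw; have := sum_traversals (fun=> 1) cw.
rewrite sum1_size; case: w cw => x p _; rewrite size_walk_edges => <-.
by apply: eq_bigr => e _; rewrite mul1n.
Qed.

(** Strong induction on the length: an overlong walk is replaced by a shorter
    one whose edges form a subfamily of its own. *)
Lemma feasible_short w :
  feasible I w -> exists w', [/\ feasible I w', size w'.2 <= 2 * (#|V| - 1) &
    walk_cost I w' <= walk_cost I w].
Proof.
have [n] := ubnP (size w.2); elim: n => // n IH in w *.
rewrite ltnS => sw fw; have [short|long] := leqP (size w.2) (2 * (#|V| - 1)).
  by exists w.
case: w sw fw long => x p /= sp fw long.
have cw : closed_walk I (x, p) by case/andP: fw.
have /andP [/= pp /eqP lp] := cw.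
have [q [C [lq C0 pC sub]]] := shorten_closed_walk lp (loopless_path pp) long.
have cq : closed_walk I (x, q).
  rewrite /closed_walk /= lq eqxx andbT path_adjE.
  by move: pp; rewrite path_adjE (perm_all _ pC) all_cat => /andP [].
have fq : feasible I (x, q).
  rewrite /feasible cq; apply/forall_inP => v vr; apply: sub.
  by case/andP: fw => _ /forall_inP; apply.
have sq : size q < n.
  apply: leq_trans sp; rewrite -(size_walk_edges x p) (perm_size pC).
  by rewrite size_cat size_walk_edges -[X in X < _]add0n ltn_add2r lt0n size_eq0.
have [w' [fw' sw' cost_w']] := IH (x, q) sq fq.
exists w'; split=> //; apply: leq_trans cost_w' _.
rewrite /walk_cost !sum_traversals // (perm_big _ pC) big_cat /=.
exact: leq_addl.
Qed.

End Instance.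

Theorem theorem3 (V : finType) (I : stsp V) :
  (exists w : walk V, feasible I w) ->
  exists w : walk V,
    optimal I w /\ total_traversals I w <= 2 * (#|V| - 1).
Proof.
case=> w0 /feasible_short [[x0 p0] [f0 s0 _]].
pose N := 2 * (#|V| - 1).
(* Bounded sequences make the walks with at most N steps a finite type. *)
pose to_walk (b : V * N.-bseq V) : walk V := (b.1, val b.2).
pose b0 : V * N.-bseq V := (x0, Bseq s0).
case: (@arg_minnP _ b0 (fun b => feasible I (to_walk b))
         (fun b => walk_cost I (to_walk b)) f0) => b fb minb.
exists (to_walk b); split; last first.
  by rewrite total_traversalsE ?size_bseq //; case/andP: fb.
split=> // w /feasible_short [[x p] [fp sp le_cost]].
exact: leq_trans (minb (x, Bseq sp) fp) le_cost.
Qed.
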